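(* Let $$p=\Big(\mathbf X^{\lambda_0^{(1)}}-\mathbf X^{\lambda_1^{(1)}}\Big)\Big(\mathbf X^{\lambda_0^{(2)}}-\mathbf X^{\lambda_1^{(2)}}\Big)\cdots\Big(\mathbf X^{\lambda_0^{(k)}}-\mathbf X^{\lambda_1^{(k)}}\Big)\sum_{j\in J}e_j\mathbf X^{\alpha_j}\in\mathbb Z[X_1,\dots,X_n],$$ where the polynomials $\mathbf X^{\lambda_0^{(i)}}-\mathbf X^{\lambda_1^{(i)}}$ ($i=1,\dots,k$) are pairwise distinct irreducible polynomials, all $\lambda_b^{(i)}$ ($b\in\{0,1\}$) are nonzero elements of $\mathbb N_0^n$, $J$ is a finite nonempty index set, $e_j\in\{1,-1\}$ and $\alpha_j\in\mathbb N_0^n$ for $j\in J$, and $\alpha_j\ne\alpha_{j'}$ whenever $e_j\ne e_{j'}$. Then $p$ contains at least $k+1$ minimal monomials.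
   Context: $\mathbb N_0$ denotes the nonnegative integers; for $\alpha\in\mathbb N_0^n$, $\mathbf X^\alpha=\prod_{i=1}^nX_i^{(\alpha)_i}$. Write a nonzero polynomial $p\in\mathbb Z[X_1,\dots,X_n]$ as $p=\sum_{\beta}c_\beta\mathbf X^\beta$ with integer coefficients; a monomial $\mathbf X^\beta$ with $c_\beta\neq 0$ is minimal in $p$ if there is no $\beta'\ne\beta$ with $c_{\beta'}\ne0$ and $\beta'\le\beta$ in the componentwise (product) order on $\mathbb N_0^n$. The number of minimal monomials of $p$ is the number of such exponent vectors $\beta$. *)

(* Defs.v *)
From HB Require Import structures.
From mathcomp Require Import all_boot all_order all_algebra.
Set Implicit Arguments. Unset Strict Implicit. Unset Printing Implicit Defensive.
Import Order.TTheory GRing.Theory Num.Theory.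
Local Open Scope ring_scope.

Definition mon (n : nat) := {ffun 'I_n -> nat}.
Definition mon0 (n : nat) : mon n := [ffun => 0%N].
Definition monD (n : nat) (a b : mon n) : mon n := [ffun i => (a i + b i)%N].
Definition monle (n : nat) (a b : mon n) : bool := [forall i, (a i <= b i)%N].

Definition mpoly (n : nat) := seq (int * mon n).

Definition coef (n : nat) (p : mpoly n) (b : mon n) : int :=
  \sum_(t <- p | t.2 == b) t.1.

Definition mzero (n : nat) : mpoly n := [::].
Definition mone (n : nat) : mpoly n := [:: (1, mon0 n)].
Definition mmul (n : nat) (p q : mpoly n) : mpoly n :=
  [seq (t.1 * s.1, monD t.2 s.2) | t <- p, s <- q].

Definition peq (n : nat) (p q : mpoly n) : Prop := forall b, coef p b = coef q b.

Definition punit (n : nat) (u : mpoly n) : Prop := exists v, peq (mmul u v) (mone n).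
Definition pirreducible (n : nat) (p : mpoly n) : Prop :=
  ~ peq p (mzero n) /\ ~ punit p /\
  forall q r, peq p (mmul q r) -> punit q \/ punit r.

Definition minimal_monomial (n : nat) (p : mpoly n) (b : mon n) : Prop :=
  coef p b != 0 /\
  forall b', b' != b -> coef p b' != 0 -> ~~ monle b' b.

Definition binom (n : nat) (l0 l1 : mon n) : mpoly n := [:: (1, l0); (-1, l1)].

Definition thm_poly (n k : nat) (lam0 lam1 : 'I_k -> mon n) (J : finType)
  (e : J -> int) (alpha : J -> mon n) : mpoly n :=
  mmul (foldr (@mmul n) (mone n) [seq binom (lam0 i) (lam1 i) | i <- enum 'I_k])
       [seq (e j, alpha j) | j <- enum J].

(* Main.v *)
(* Only two consequences of the hypotheses matter: the last factor is nonzero,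
   and the exponents of each binomial are incomparable, so that some weight
   vector with positive entries is orthogonal to their difference [d_i].
   Monomials of [p] of least weight for some positive weight are minimal, so it
   suffices to find [k + 1] points of the support [S] of [p] lying on faces of
   [S] selected by positive weights [w].

   Algebra: the [w]-initial form of [p] is divisible by every binomial with
   [<w, d_i> = 0].  If there are [m] of those, it vanishes to order [m] at
   [(1, ..., 1)], which forces it to have more than [m] terms: otherwise a
   product of fewer than [m] affine forms isolates one term.

   Convexity: cut an open cone of weights along the hyperplane [d^⊥].  The two
   halves select disjoint sets of points of [S].  A minimal face on the
   hyperplane is a segment parallel to [d] with at least [m + 1] points, where
   [m] directions are lost by the cut, and its [m - 1] inner points are selected
   by neither half.  Induction on the number of directions whose hyperplane
   meets the cone gives [k + 1] points. *)
Require Import Defs.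
From HB Require Import structures.
From mathcomp Require Import all_boot all_order all_algebra.
From mathcomp Require Import zify ring lra.
Import Order.TTheory GRing.Theory Num.Theory.
Local Open Scope ring_scope.

(** * Splitting and counting lists *)

(** This distributes the directions that survive a cut between the two half-cones; one that suits
    both goes to only one, so nothing is counted twice. *)
Lemma perm_cat_or {T : eqType} (P Q : T -> Prop) (s : seq T) :
  {in s, forall x, P x \/ Q x} ->
  exists r1 r2, [/\ perm_eq s (r1 ++ r2), {in r1, forall x, P x} &
    {in r2, forall x, Q x}].
Proof.
elim: s => [|x s IH] h; first by exists [::], [::].
have [|r1 [r2 [pe h1 h2]]] := IH; first by move=> y ys; apply: h; rewrite inE ys orbT.
have [Px|Qx] := h x (mem_head _ _).
  exists (x :: r1), r2; split=> //; first by rewrite /= perm_cons.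
  by move=> y; rewrite inE => /predU1P[->//|/h1].
exists r1, (x :: r2); split=> //.
  by rewrite perm_sym -cat1s perm_catCA /= perm_cons perm_sym.
by move=> y; rewrite inE => /predU1P[->//|/h2].
Qed.

Lemma size_le1 {T : eqType} (s : seq T) :
  uniq s -> {in s &, forall x y, x = y} -> (size s <= 1)%N.
Proof.
case: s => [|x [|y s]] //= /andP[+ _] h.
by rewrite (h x y) ?inE ?eqxx ?orbT.
Qed.

(** Injectivity allows at most one minimiser and one maximiser of [h]; every other entry lies
    strictly between two values. *)
Lemma size_between {T : eqType} (h : T -> int) (s : seq T) :
  uniq s -> {in s &, injective h} ->
  (size s <= (size [seq x <- s | has (fun y => h y < h x)%R s &&
                                has (fun y => h x < h y)%R s]).+2)%N.
Proof.
move=> us hI; set P := (fun x => has _ s && _); pose mn x := all (fun y => h x <= h y) s.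
pose mx x := all (fun y => h y <= h x) s.
have cmn : (count mn s <= 1)%N.
  rewrite -size_filter; apply: size_le1; first exact: filter_uniq.
  move=> x y; rewrite !mem_filter => /andP[/allP hx xs] /andP[/allP hy ys].
  by apply: hI => //; apply/eqP; rewrite eq_le hx // hy.
have cmx : (count mx s <= 1)%N.
  rewrite -size_filter; apply: size_le1; first exact: filter_uniq.
  move=> x y; rewrite !mem_filter => /andP[/allP hx xs] /andP[/allP hy ys].
  by apply: hI => //; apply/eqP; rewrite eq_le hx // hy.
have ePC : count (predC P) s = count (predU mn mx) s.
  apply: eq_count => x; rewrite /= negb_and -!all_predC; congr (_ || _).
    by apply: eq_all => y /=; rewrite leNgt.
  by apply: eq_all => y /=; rewrite leNgt.
rewrite size_filter -(count_predC P s) ePC.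
have := count_predUI mn mx s; lia.
Qed.

Lemma two_sided_min (p q a a' b b' : int) : 0 < p -> 0 < q ->
  a' <= a -> b' <= b -> p * a + q * b <= p * a' + q * b' -> b = b'.
Proof.
move=> p0 q0 aa bb; have : p * a' <= p * a by rewrite ler_pM2l.
move=> h h'; apply/eqP; rewrite eq_le bb andbT -(ler_pM2l q0); lra.
Qed.

(** * The integer dot product *)

Definition dot {n : nat} (u v : 'rV[int]_n) : int := \sum_i u 0 i * v 0 i.

Lemma dotC {n} (u v : 'rV[int]_n) : dot u v = dot v u.
Proof. by apply: eq_bigr => i _; rewrite mulrC. Qed.

Lemma dotDl {n} (u u' v : 'rV[int]_n) : dot (u + u') v = dot u v + dot u' v.
Proof. by rewrite -big_split; apply: eq_bigr => i _; rewrite mxE mulrDl. Qed.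

Lemma dotZl {n} a (u v : 'rV[int]_n) : dot (a *: u) v = a * dot u v.
Proof. by rewrite big_distrr; apply: eq_bigr => i _; rewrite mxE -mulrA. Qed.

Lemma dotNl {n} (u v : 'rV[int]_n) : dot (- u) v = - dot u v.
Proof. by rewrite -scaleN1r dotZl mulN1r. Qed.

Lemma dotDr {n} (u v v' : 'rV[int]_n) : dot u (v + v') = dot u v + dot u v'.
Proof. by rewrite dotC dotDl !(dotC _ u). Qed.

Lemma dotZr {n} a (u v : 'rV[int]_n) : dot u (a *: v) = a * dot u v.
Proof. by rewrite dotC dotZl dotC. Qed.

Lemma dotNr {n} (u v : 'rV[int]_n) : dot u (- v) = - dot u v.
Proof. by rewrite dotC dotNl dotC. Qed.

Lemma dot0r {n} (u : 'rV[int]_n) : dot u 0 = 0.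
Proof. by rewrite -(scale0r 0) dotZr mul0r. Qed.

Definition dotE {n} :=
  (@dotDl n, @dotDr n, @dotNl n, @dotNr n, @dotZl n, @dotZr n).

Lemma dot_delta {n} (u : 'rV[int]_n) i : dot u (delta_mx 0 i) = u 0 i.
Proof.
rewrite /dot (bigD1 i) //= mxE !eqxx mulr1 big1 ?addr0 // => j ji.
by rewrite mxE (negbTE ji) mulr0.
Qed.

Lemma dot_gt0 {n} (d : 'rV[int]_n) : d != 0 -> 0 < dot d d.
Proof.
move=> d0; rewrite lt_def sumr_ge0 ?andbT => [|i _]; last exact: sqr_ge0.
apply: contra d0 => /eqP dd; apply/eqP/rowP => i; rewrite mxE.
have := @psumr_eq0P _ _ predT (fun i => d 0 i * d 0 i) (fun i _ => sqr_ge0 _) dd i isT.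
by move/eqP; rewrite mulf_eq0 orbb => /eqP.
Qed.

(** A value [dot w c] that is positive is at least 1, so a multiple of [w] exceeding all the
    [dot u c] in absolute value dominates [u]. *)
Lemma perturb {n} (w u : 'rV[int]_n) (cs : seq 'rV[int]_n) :
  exists N : int,
    {in cs, forall c, 0 < dot w c -> 0 < dot (N *: w + u) c}.
Proof.
exists (1 + \sum_(c <- cs) `|dot u c|) => c cin wc; rewrite !dotE.
have : `|dot u c| <= \sum_(c <- cs) `|dot u c|.
  by rewrite (big_rem c) //= lerDl sumr_ge0.
set s := \sum_(_ <- _) _ => us.
have : 1 + s <= (1 + s) * dot w c by rewrite ler_peMr; lia.
lia.
Qed.

(** * Cones of weights, faces, and the count of selected points *)

Definition incone {n} (cs : seq 'rV[int]_n) (w : 'rV[int]_n) :=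
  all (fun c => 0 < dot w c) cs.

Definition face {n} (S : seq 'rV[int]_n) (w : 'rV[int]_n) :=
  [seq x <- S | all (fun y => dot w x <= dot w y) S].

Lemma faceP {n} (S : seq 'rV[int]_n) w x :
  reflect (x \in S /\ {in S, forall y, dot w x <= dot w y}) (x \in face S w).
Proof.
by rewrite mem_filter andbC; apply: (iffP andP) => -[xS /allP].
Qed.

Lemma perturb_face {n} (S cs : seq 'rV[int]_n) w u : incone cs w ->
  exists N : int, incone cs (N *: w + u) /\
    {subset face S (N *: w + u) <= face S w}.
Proof.
move=> /allP Cw.
(* Including the differences of points of [S] keeps strict inequalities strict, so a point that was
   not minimal cannot become minimal. *)
have [N HN] := perturb w u (cs ++ [seq x - y | x <- S, y <- S]).
exists N; split.
  by apply/allP => c cin; apply: HN; rewrite ?mem_cat ?cin ?Cw.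
move=> x /faceP[xS xmin]; apply/faceP; split=> // y yS.
rewrite leNgt; apply/negP => yx.
have := HN (x - y); rewrite mem_cat (allpairs_f _ xS yS) orbT => /(_ isT).
by have := xmin y yS; rewrite !dotE; lia.
Qed.

(* Take [w'] with smallest face: if the face were not a segment parallel to [d],
   tilting [w'] within the hyperplane orthogonal to [d] would shrink it. *)
Lemma thin_face {n} (S cs : seq 'rV[int]_n) d w : uniq S -> d != 0 -> incone cs w -> dot w d = 0 ->
  exists w', [/\ incone cs w', dot w' d = 0, {subset face S w' <= face S w} &
    {in face S w' &, forall x y, dot d d *: (x - y) = dot d (x - y) *: d}].
Proof.
move=> uS d0; have [k] := ubnP (size (face S w)); elim: k w => // k IH w.
rewrite ltnS => szw Cw wd.
have [/allP thin|/allPn] := boolP (all (fun x => all (fun y =>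
    dot d d *: (x - y) == dot d (x - y) *: d) (face S w)) (face S w)).
  by exists w; split=> // x y /thin /allP + yw => /(_ y yw)/eqP.
case=> x xw /allPn[y yw] /eqP/rowP nthin.
have [i hi] : exists i, (dot d d *: (x - y)) 0 i != (dot d (x - y) *: d) 0 i.
  apply/existsP; apply: contraT; rewrite negb_exists => /forallP h.
  by case: nthin => i; have /negPn/eqP := h i.
(* [dot d d] times the projection of the [i]-th unit vector off [d]; its product with [x - y] is the
   [i]-th entry of the difference of the two sides of the failing identity. *)
pose u := dot d d *: delta_mx 0 i - d 0 i *: d.
have ud : dot u d = 0 by rewrite /u !dotE (dotC _ d) dot_delta; ring.
have uxy : dot u x != dot u y.
  rewrite -subr_eq0; apply: contra hi => /eqP uxy.
  rewrite -subr_eq0 !mxE !dotE -uxy /u !dotE !(dotC (delta_mx _ _)) !dot_delta.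
  by apply/eqP; ring.
clearbody u.
have [N [Cw' sub]] := perturb_face S _ _ u Cw.
have w'd : dot (N *: w + u) d = 0 by rewrite !dotE wd ud mulr0 addr0.
have [|//|//|w'' [C'' d'' sub'' t'']] := IH (N *: w + u); last first.
  by exists w''; split=> // z /sub''/sub.
apply: leq_trans szw; rewrite ltnNge; apply/negP => szle.
(* Without a drop in size the faces would coincide, and [x] and [y] would both be minimal for the
   tilted weight, although [u] separates them. *)
have [|_ eqf] := uniq_min_size _ sub szle; first exact: filter_uniq.
have /faceP[xS xm] := xw; have /faceP[yS ym] := yw.
move: xw yw; rewrite -!eqf => /faceP[_ /(_ y yS)] + /faceP[_ /(_ x xS)].
have exy : dot w x = dot w y by apply/eqP; rewrite eq_le xm ?ym.
by move: uxy; rewrite !dotE exy; lia.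
Qed.

(** Polynomials enter only through the bound on face sizes. Sublists of [ds] inherit it, so the
    induction concerns only directions and cones. *)
Lemma size_faces {n} (S cs ds : seq 'rV[int]_n) :
  uniq S ->
  (forall w, (count (fun d => dot w d == 0%R) ds < size (face S w))%N) ->
  (exists w, incone cs w) ->
  {in ds, forall d, d != 0 /\ exists2 w, incone cs w & dot w d = 0} ->
  exists s, [/\ uniq s, (size ds < size s)%N &
    {in s, forall x, exists2 w, incone cs w & x \in face S w}].
Proof.
move=> uS; have [k] := ubnP (size ds); elim: k ds cs => // k IH [|d ds'] cs.
  move=> _ hA [w Cw] _; have := hA w; case E: (face S w) => [//|x r] _.
  exists [:: x]; split=> // y; rewrite inE => /eqP->.
  by exists w; rewrite ?E ?mem_head.
set ds := d :: ds'; rewrite ltnS => szk hA _ hd.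
have [d0 [w Cw wd]] := hd d (mem_head _ _).
have dd0 := dot_gt0 _ d0.
(* Along a segment parallel to [d], every weight is proportional to [dot d]. *)
have thin_sep w1 x y : dot d d *: (x - y) = dot d (x - y) *: d ->
    dot d d * (dot w1 x - dot w1 y) = (dot d x - dot d y) * dot w1 d.
  by move=> /(congr1 (dot w1)); rewrite !dotE.
have [w' [Cw' w'd _ thin]] := thin_face S _ _ _ uS d0 Cw wd.
pose m := count (fun d => dot w' d == 0) ds.
have inj_d : {in face S w' &, injective (dot d)}.
  move=> x y xF yF exy; have := thin x y xF yF.
  rewrite !dotE exy subrr scale0r => /eqP.
  by rewrite scalemx_eq0 gt_eqF //= subr_eq0 => /eqP.
have m0 w1 : dot w1 d = 0 -> (1 < size (face S w1))%N.
  by move=> w1d; apply: leq_trans (hA w1); rewrite /= w1d eqxx.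
pose s0 := [seq x <- face S w' |
  has (fun y => dot d y < dot d x) (face S w') &&
  has (fun y => dot d x < dot d y) (face S w')].
(* A weight off the hyperplane is strictly monotone along the segment, so an inner point is beaten
   by one of its neighbours [y], [z]. *)
have s0P x w1 : x \in s0 -> dot w1 d != 0 -> x \notin face S w1.
  rewrite mem_filter => /andP[/andP[/hasP[y yF yx] /hasP[z zF xz]] xF] w1d.
  apply/negP => /faceP[_ xmin].
  have /faceP[yS _] := yF; have /faceP[zS _] := zF.
  have ey := thin_sep w1 _ _ (thin x y xF yF).
  have ez := thin_sep w1 _ _ (thin x z xF zF).
  have := xmin y yS; have := xmin z zS; move: yx xz; 
  by move: (dot w1 x) (dot w1 y) (dot w1 z) (dot w1 d) (dot d x) (dot d y)
    (dot d z) (dot d d) ey ez w1d dd0 => *; nia.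
(* Of the more than [m] points of the segment, only its two ends are dropped. *)
have szs0 : (m <= (size s0).+1)%N.
  by have := leq_trans (hA w') (size_between _ _ (filter_uniq _ uS) inj_d).
pose rest := [seq e <- ds | dot w' e != 0].
have szrest : (m + size rest)%N = size ds by rewrite size_filter count_predC.
pose cp := d :: cs; pose cm := - d :: cs.
have [|r1 [r2 [pe h1 h2]]] := perm_cat_or
    (fun e => exists2 w, incone cp w & dot w e = 0)
    (fun e => exists2 w, incone cm w & dot w e = 0) rest.
  move=> e; rewrite mem_filter => /andP[w'e /hd[e0 [w1 Cw1 w1e]]].
  suff [w2 [Cw2 w2e]] : exists w2, [/\ incone cs w2, dot w2 e = 0 & dot w2 d != 0].
    rewrite neq_lt => /orP[lt0|gt0]; [right|left]; exists w2 => //.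
      by rewrite /incone /= dotNr oppr_gt0 lt0.
    by rewrite /incone /= gt0.
  have [w1d|w1d] := eqVneq (dot w1 d) 0; last by exists w1.
  (* The added vector is orthogonal to [e], and its product with [d] is [dot w' e * dot d d], which
     is nonzero: the weight leaves the hyperplane of [d] within that of [e]. *)
  have [N [CN _]] := perturb_face S _ _ (dot w' e *: d - dot d e *: w') Cw1.
  exists (N *: w1 + (dot w' e *: d - dot d e *: w')); split=> //.
    by rewrite !dotE w1e; ring.
  rewrite !dotE w1d w'd !mulr0 oppr0 add0r addr0.
  by rewrite mulf_neq0 // gt_eqF.
have szr : (size r1 + size r2 = size rest)%N by rewrite -size_cat (perm_size pe).
have m1 : (0 < m)%N by rewrite /m /= w'd eqxx.
have sub_count (r : seq _) w1 : (count (fun e => dot w1 e == 0%R) r <=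
    count (fun e => dot w1 e == 0%R) (r1 ++ r2))%N ->
    (count (fun e => dot w1 e == 0%R) r < size (face S w1))%N.
  move=> /leq_ltn_trans; apply; apply: leq_ltn_trans (hA w1).
  by rewrite -(permP pe) count_filter; apply: sub_count => x /andP[].
have ds_r x : x \in r1 ++ r2 -> x != 0.
  by rewrite -(perm_mem pe) mem_filter => /andP[_ /hd[]].
have [|||| s1 [u1 sz1 f1]] := IH r1 cp.
- by move: szr szrest szk; rewrite /=; lia.
- by move=> w1; apply: sub_count; rewrite count_cat leq_addr.
- have [N [CN _]] := perturb_face S _ _ d Cw'.
  by exists (N *: w' + d); rewrite /incone /= !dotE w'd mulr0 add0r dd0.
- by move=> e er; split; [apply: ds_r; rewrite mem_cat er | apply: h1].
have [|||| s2 [u2 sz2 f2]] := IH r2 cm.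
- by move: szr szrest szk; rewrite /=; lia.
- by move=> w1; apply: sub_count; rewrite count_cat leq_addl.
- have [N [CN _]] := perturb_face S _ _ (- d) Cw'.
  by exists (N *: w' - d); rewrite /incone /= !dotE w'd mulr0 add0r opprK dd0.
- by move=> e er; split; [apply: ds_r; rewrite mem_cat er orbT| apply: h2].
exists (s0 ++ s1 ++ s2); split.
- rewrite !cat_uniq u1 u2 !filter_uniq //= andbT; apply/andP; split.
    rewrite has_cat negb_or; apply/andP; split; apply/hasPn => x.
      move=> /f1[w1 /andP[w1d _] xF]; apply/negP => /s0P/(_ (lt0r_neq0 w1d)).
      by rewrite xF.
    move=> /f2[w1 /andP[+ _] xF]; rewrite dotNr oppr_gt0 => /ltr0_neq0 w1d.
    by apply/negP => /s0P/(_ w1d); rewrite xF.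
  apply/hasPn => x /f2[w2 /andP[+ C2] xF2]; rewrite dotNr oppr_gt0 => w2d.
  apply/negP => /f1[w1 /andP[w1d C1] xF1].
  (* A positive combination of [w1] and [w2] on the hyperplane of [d]. By [two_sided_min] its face
     lies on one level of [w1], so a thin subface parallel to [d] is a single point, while [m0]
     demands two. *)
  pose v := dot w1 d *: w2 - dot w2 d *: w1.
  have vd : dot v d = 0 by rewrite !dotE; ring.
  have Cv : incone cs v.
    apply/allP => c cin; have := allP C1 c cin; have := allP C2 c cin.
    rewrite /v !dotE => c2 c1.
    by rewrite -mulNr addr_gt0 // mulr_gt0 // oppr_gt0.
  have [v' [Cv' v'd sub thin']] := thin_face S _ _ _ uS d0 Cv vd.
  have uF : uniq (face S v') by rewrite filter_uniq.
  suff : (size (face S v') <= 1)%N by rewrite leqNgt m0.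
  apply: size_le1 => // y z yF zF.
  have [xS x1] := faceP _ _ _ xF1; have [_ x2] := faceP _ _ _ xF2.
  have toF1 t : t \in face S v' -> dot w1 t = dot w1 x.
    move=> /sub /faceP[tS /(_ x xS)]; have := x1 t tS; have := x2 t tS.
    rewrite /v !dotE -!mulNr => wt2 wt1; apply: two_sided_min => //.
    by rewrite oppr_gt0.
  have := thin_sep w1 _ _ (thin' y z yF zF).
  rewrite (toF1 y) // (toF1 z) // subrr mulr0 => /esym/eqP.
  rewrite mulf_eq0 (gt_eqF w1d) orbF subr_eq0 => /eqP edyz.
  have := thin' y z yF zF; rewrite !dotE edyz subrr scale0r => /eqP.
  by rewrite scalemx_eq0 gt_eqF //= subr_eq0 => /eqP.
(* The total is at least [(m - 1) + (size r1 + 1) + (size r2 + 1)], which is [size ds + 1]. *)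
- rewrite !size_cat; move: sz1 sz2 szs0 szr szrest; rewrite /=; lia.
- move=> x; rewrite !mem_cat => /or3P[].
  + by rewrite mem_filter => /andP[_ xF]; exists w'.
  + by move=> /f1[w1 /andP[_ C1]]; exists w1.
  + by move=> /f2[w1 /andP[_ C1]]; exists w1.
Qed.

(** * Exponents as vectors and polynomials as functionals *)

Definition mvec {n} (b : mon n) : 'rV[int]_n := \row_i (b i)%:Z.

Lemma mvecD {n} (a b : mon n) : mvec (monD a b) = mvec a + mvec b.
Proof. by apply/rowP => i; rewrite !mxE ffunE PoszD. Qed.

Lemma mvec_inj {n} : injective (@mvec n).
Proof.
by move=> a b /rowP ab; apply/ffunP => i; have := ab i; rewrite !mxE => -[].
Qed.

Lemma monDA {n} (a b c : mon n) : monD a (monD b c) = monD (monD a b) c.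
Proof. by apply/ffunP => i; rewrite !ffunE addnA. Qed.

Lemma mon0D {n} (a : mon n) : monD (mon0 n) a = a.
Proof. by apply/ffunP => i; rewrite !ffunE. Qed.

Lemma monD0 {n} (a : mon n) : monD a (mon0 n) = a.
Proof. by apply/ffunP => i; rewrite !ffunE addn0. Qed.

Lemma seq_argmax {T : eqType} (f : T -> int) (s : seq T) : (exists x, x \in s) ->
  exists2 x, x \in s & {in s, forall y, f y <= f x}.
Proof.
elim: s => [[]//|x s IH _].
case: s IH => [_|z s /(_ (ex_intro _ z (mem_head z s)))[y ys ymax]].
  by exists x; rewrite ?mem_head // => y; rewrite inE => /eqP->.
have [xy|/ltW yx] := leP (f x) (f y).
  exists y; first by rewrite inE ys orbT.
  by move=> t; rewrite inE => /predU1P[->//|/ymax].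
exists x; first exact: mem_head.
by move=> t; rewrite inE => /predU1P[->//|/ymax/le_trans]; apply.
Qed.

(* A polynomial acts linearly on functions of the exponent; multiplication by
   a binomial becomes a difference operator. *)
Definition pair {n} (p : mpoly n) (h : mon n -> int) : int :=
  \sum_(t <- p) t.1 * h t.2.

Definition supp {n} (p : mpoly n) : seq (mon n) :=
  [seq b <- undup [seq t.2 | t <- p] | coef p b != 0].

Lemma supp_uniq {n} (p : mpoly n) : uniq (supp p).
Proof. by rewrite filter_uniq ?undup_uniq. Qed.

Lemma mem_supp {n} (p : mpoly n) b : (b \in supp p) = (coef p b != 0).
Proof.
rewrite mem_filter andb_idr // mem_undup; apply: contraR => bp.
rewrite /coef big_seq_cond big1 // => t /andP[tp /eqP tb].
by rewrite -tb map_f in bp.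
Qed.

Lemma pair_supp {n} (p : mpoly n) h :
  pair p h = \sum_(b <- supp p) coef p b * h b.
Proof.
rewrite /pair big_filter [RHS]big_mkcond.
transitivity (\sum_(b <- undup [seq t.2 | t <- p]) coef p b * h b); last first.
  by apply: eq_bigr => b _; case: eqP => // ->; rewrite mul0r.
transitivity (\sum_(b <- undup [seq t.2 | t <- p])
    \sum_(t <- p) (if t.2 == b then t.1 * h t.2 else 0)).
  rewrite exchange_big /=; apply: eq_big_seq => t tp.
  rewrite (bigD1_seq t.2) ?undup_uniq ?mem_undup ?map_f //= eqxx.
  by rewrite big1 ?addr0 // => b; rewrite eq_sym => /negbTE->.
apply: eq_bigr => b _; rewrite /coef big_distrl /= [RHS]big_mkcond.
by apply: eq_bigr => t _; case: eqP => // ->.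
Qed.

Lemma eq_pair {n} (p : mpoly n) h h' : h =1 h' -> pair p h = pair p h'.
Proof. by move=> hh; apply: eq_bigr => t _; rewrite hh. Qed.

Lemma pair_peq {n} (p q : mpoly n) h : peq p q -> pair p h = pair q h.
Proof.
move=> pq; rewrite !pair_supp (perm_big (supp q)).
  by apply: eq_bigr => b _; rewrite pq.
by rewrite uniq_perm ?supp_uniq // => b; rewrite !mem_supp pq.
Qed.

Lemma coef_pair {n} (p : mpoly n) b : coef p b = pair p (fun x => (x == b)%:R).
Proof.
rewrite /coef big_mkcond; apply: eq_bigr => t _.
by case: eqP; rewrite ?mulr1 ?mulr0.
Qed.

Lemma pair_mul {n} (p q : mpoly n) h :
  pair (mmul p q) h = pair p (fun a => pair q (fun b => h (monD a b))).
Proof.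
rewrite /pair big_allpairs_dep; apply: eq_bigr => t _; rewrite big_distrr.
by apply: eq_bigr => s _ /=; rewrite mulrA.
Qed.

Lemma pair_binom {n} (a b : mon n) h : pair (binom a b) h = h a - h b.
Proof. by rewrite /pair !big_cons big_nil /= addr0 mul1r mulN1r. Qed.

Lemma pair_neq0 {n} (p : mpoly n) h :
  pair p h != 0 -> exists2 b, b \in supp p & h b != 0.
Proof.
rewrite pair_supp => /eqP ph.
have [/hasP|/hasPn h0] := boolP (has (fun b => h b != 0) (supp p)); first by [].
case: ph; rewrite big_seq big1 // => b /h0 /negPn/eqP->; exact: mulr0.
Qed.

(** * Finite differences and initial forms *)

(** These are the integer-valued polynomial functions of degree below [m]; pairing to zero with all
    of them expresses vanishing to order [m] at [(1, ..., 1)]. *)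
Fixpoint deg_lt {n} (m : nat) (h : mon n -> int) : Prop :=
  if m is m'.+1 then
    forall a b, deg_lt m' (fun x => h (monD a x) - h (monD b x))
  else h =1 fun=> 0.

Lemma deg_ltS {n} m (h : mon n -> int) :
  (forall a b, deg_lt m (fun x => h (monD a x) - h (monD b x))) ->
  deg_lt m.+1 h.
Proof. by []. Qed.

Lemma eq_deg_lt {n} m (h h' : mon n -> int) :
  h =1 h' -> deg_lt m h -> deg_lt m h'.
Proof.
elim: m h h' => [|m IH] h h' hh; first by move=> h0 x; rewrite -hh.
by move=> dh a b; apply: IH (dh a b) => x; rewrite !hh.
Qed.

Lemma deg_lt_shift {n} m (h : mon n -> int) c :
  deg_lt m h -> deg_lt m (fun x => h (monD c x)).
Proof.
case: m => [h0 x|m dh a b]; first exact: h0.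
by apply: eq_deg_lt (dh (monD c a) (monD c b)) => x; rewrite !monDA.
Qed.

Lemma deg_ltD {n} m (h h' : mon n -> int) :
  deg_lt m h -> deg_lt m h' -> deg_lt m (fun x => h x + h' x).
Proof.
elim: m h h' => [|m IH] h h' dh dh'; first by move=> x; rewrite dh dh'.
by move=> a b; apply: eq_deg_lt (IH _ _ (dh a b) (dh' a b)) => x; ring.
Qed.

Lemma deg_ltZ {n} m c (h : mon n -> int) :
  deg_lt m h -> deg_lt m (fun x => c * h x).
Proof.
elim: m h => [|m IH] h dh; first by move=> x; rewrite dh mulr0.
by move=> a b; apply: eq_deg_lt (IH _ (dh a b)) => x; ring.
Qed.

Lemma deg_ltW {n} m m' (h : mon n -> int) :
  (m <= m')%N -> deg_lt m h -> deg_lt m' h.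
Proof.
elim: m' m h => [|m' IH] [|m] h //.
  move=> _ h0 a b; apply: (IH 0%N) => // x; by rewrite !h0 subrr.
by move=> mm dh a b; apply: IH (dh a b).
Qed.

Lemma deg_lt_affine {n} m v c (h : mon n -> int) :
  deg_lt m h -> deg_lt m.+1 (fun x => (dot v (mvec x) + c) * h x).
Proof.
elim: m c h => [|m IH] c h dh; apply: deg_ltS => a b.
  by move=> x; rewrite !dh !mulr0 subrr.
(* Discrete Leibniz rule: the difference of the affine factor is a constant. *)
apply: (@eq_deg_lt _ m.+1 (fun x =>
  (dot v (mvec x) + (dot v (mvec a) + c)) * (h (monD a x) - h (monD b x)) +
  (dot v (mvec a) - dot v (mvec b)) * h (monD b x))).
  by move=> x; rewrite !mvecD !dotE; ring.
apply: deg_ltD; first exact: IH.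
by apply: deg_ltZ; apply: deg_lt_shift.
Qed.

(** The factor for [y] is zero at [y] and positive at [x0] when [y] differs from [x0], so the
    product isolates [x0] from [s]. *)
Lemma deg_lt_prod {n} (x0 : mon n) (s : seq (mon n)) :
  deg_lt (size s).+1 (fun x =>
    \prod_(y <- s) dot (mvec x0 - mvec y) (mvec x - mvec y)).
Proof.
elim: s => [|y s IH]; first by move=> a b x; rewrite !big_nil subrr.
change (size (y :: s)).+1 with (size s).+2.
apply: eq_deg_lt (deg_lt_affine _ (mvec x0 - mvec y)
  (dot (mvec x0 - mvec y) (- mvec y)) _ IH) => x.
by rewrite big_cons -dotDr.
Qed.

(* [mu] is the order of [p] for the weight [w], and the initial form of [p]
   vanishes to order [m] at the point [(1, ..., 1)]. *)
Definition initial_vanish {n} (w : 'rV[int]_n) (mu : int) (m : nat) (p : mpoly n) :=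
  [/\ {in supp p, forall b, mu <= dot w (mvec b)},
      exists2 b, b \in supp p & dot w (mvec b) = mu &
      forall h, deg_lt m h -> pair p (fun x => (dot w (mvec x) == mu)%:R * h x) = 0].

Lemma initial_vanish_size {n} (w : 'rV[int]_n) mu m p : initial_vanish w mu m p ->
  (m < size (face [seq mvec b | b <- supp p] w))%N.
Proof.
case=> lb [b0 b0p b0mu] van; rewrite ltnNge; apply/negP => szm.
pose G := [seq b <- supp p | dot w (mvec b) == mu].
have uG : uniq G by rewrite filter_uniq ?supp_uniq.
have {}szm : (size G <= m)%N.
  apply: leq_trans szm; rewrite -(size_map mvec) uniq_leq_size //=.
    by rewrite (map_inj_uniq mvec_inj) filter_uniq ?supp_uniq.
  move=> _ /mapP[b + ->]; rewrite mem_filter => /andP[/eqP bmu bp].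
  apply/faceP; split; first exact: map_f.
  by move=> _ /mapP[c cp ->]; rewrite bmu lb.
have b0G : b0 \in G by rewrite mem_filter b0mu eqxx.
(* Without [b0] there are [size G - 1] factors, so the test function has degree below [size G],
   hence below [m]; its pairing reduces to the nonzero term at [b0]. *)
have := deg_lt_prod b0 (rem b0 G); rewrite size_rem // prednK; last first.
  by case: (G) b0G.
move/(deg_ltW _ _ _ szm)/van/eqP.
rewrite pair_supp (bigD1_seq b0) ?supp_uniq //= [X in _ + X]big1_seq => [|b].
  rewrite addr0 b0mu eqxx mul1r mulf_eq0 => /orP[c0|].
    by move: b0p; rewrite mem_supp c0.
  rewrite prodf_seq_eq0 => /hasP[b bG /=]; rewrite gt_eqF // dot_gt0 //.
  rewrite subr_eq0; apply/eqP => /mvec_inj b0b; move: bG.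
  by rewrite (mem_rem_uniq _ uG) inE b0b eqxx.
move=> /andP[bb0 bp]; have [bmu|_] := eqP; last by rewrite mul0r mulr0.
rewrite (big_rem b) ?subrr /=; last first.
  by rewrite (mem_rem_uniq _ uG) inE bb0 mem_filter bmu eqxx.
by rewrite dot0r mul0r !mulr0.
Qed.


Lemma eq_pair_supp {n} (p : mpoly n) h h' :
  {in supp p, h =1 h'} -> pair p h = pair p h'.
Proof.
by move=> hh; rewrite !pair_supp; apply: eq_big_seq => b bp; rewrite hh.
Qed.

(** The initial form is multiplied by the whole binomial when [a] and [b] have equal weight, gaining
    one order, and by the monomial of [a] alone otherwise. The scalar [c] absorbs the sign when the
    exponents are swapped. *)
Lemma initial_vanish_binom_le {n} (w : 'rV[int]_n) mu m (p p' : mpoly n) c a b :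
  initial_vanish w mu m p -> c != 0 -> a != b ->
  dot w (mvec a) <= dot w (mvec b) ->
  (forall h, pair p' h = c * pair p (fun x => h (monD a x) - h (monD b x))) ->
  initial_vanish w (dot w (mvec a) + mu)
    (m + (dot w (mvec a) == dot w (mvec b))) p'.
Proof.
move=> [lb [b0 b0p b0mu] van] c0 ab wab pE; split.
- move=> y; rewrite mem_supp coef_pair pE mulf_eq0 (negbTE c0) => /pair_neq0[x xp].
  have := lb x xp; have [<- wx _|_] := eqVneq (monD a x) y.
    by rewrite mvecD dotDr lerD2l.
  have [<- wx _|_ _] := eqVneq (monD b x) y; last by rewrite subrr eqxx.
  by rewrite mvecD dotDr lerD.
- pose G := [seq x <- supp p | dot w (mvec x) == mu].
  (* No cancellation at [a + x]: it could only come from [y = x + (a - b)],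
     which is further along [a - b] than [x]. *)
  have [|x] := seq_argmax (fun x => dot (mvec a - mvec b) (mvec x)) G.
    by exists b0; rewrite mem_filter b0mu eqxx.
  rewrite mem_filter => /andP[/eqP xmu xp] xmax.
  exists (monD a x); last by rewrite mvecD dotDr xmu.
  rewrite mem_supp coef_pair pE mulf_neq0 //.
  rewrite (eq_pair_supp _ _ (fun y => (y == x)%:R)) -?coef_pair -?mem_supp //.
  move=> y yp /=; have [byax|_] := eqVneq (monD b y) (monD a x).
    have := congr1 mvec byax; rewrite !mvecD => byax'.
    have yE : mvec y = mvec a - mvec b + mvec x.
      by rewrite addrAC -byax' addrC addKr.
    have := lb y yp; rewrite yE !dotE xmu => wy.
    have yG : y \in G.
      rewrite mem_filter yp yE !dotE xmu; apply/andP; split=> //.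
      by apply/eqP; lia.
    have := xmax y yG; rewrite yE dotDr gerDr leNgt dot_gt0 //.
    by rewrite subr_eq0; apply: contra ab => /eqP/mvec_inj ->.
  rewrite subr0; congr (_%:R); congr nat_of_bool; apply/eqP/eqP => [|-> //].
  by move/(congr1 mvec); rewrite !mvecD => /addrI/mvec_inj.
- move=> h dh; rewrite pE; apply/eqP; rewrite mulf_eq0 (negbTE c0); apply/eqP.
  have [wE|wN] := eqVneq (dot w (mvec a)) (dot w (mvec b)).
    move: dh; rewrite wE eqxx addn1 => dh; rewrite -[RHS](van _ (dh a b)).
    apply: eq_pair => x; rewrite !mvecD !dotDr wE !(inj_eq (addrI _)).
    by rewrite mulrBr.
  move: dh; rewrite (negbTE wN) addn0 => dh.
  rewrite -[RHS](van _ (deg_lt_shift _ _ a dh)).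
  apply: eq_pair_supp => x xp.
  rewrite !mvecD !dotDr (inj_eq (addrI _)).
  have -> : (dot w (mvec b) + dot w (mvec x) == dot w (mvec a) + mu) = false.
    by apply/eqP; have := lb x xp; lia.
  by rewrite mul0r subr0.
Qed.

Lemma initial_vanish_binom {n} (w : 'rV[int]_n) mu m (p p' : mpoly n) a b :
  initial_vanish w mu m p -> a != b ->
  (forall h, pair p' h = pair p (fun x => h (monD a x) - h (monD b x))) ->
  exists mu', initial_vanish w mu'
    ((dot w (mvec a - mvec b) == 0) + m)%N p'.
Proof.
move=> vp ab pE; rewrite dotDr dotNr subr_eq0 addnC.
have [wab|/ltW wba] := leP (dot w (mvec a)) (dot w (mvec b)).
  eexists; apply: (initial_vanish_binom_le _ _ _ _ _ 1 _ _ vp) => // h.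
  by rewrite mul1r.
rewrite eq_sym; eexists.
apply: (initial_vanish_binom_le _ _ _ _ _ (-1) _ _ vp) => //; first by rewrite eq_sym.
move=> h; rewrite pE /pair big_distrr /=; apply: eq_bigr => t _; ring.
Qed.

Lemma initial_vanish_prod {n} {I : eqType} (l : seq I) (a b : I -> mon n) (q : mpoly n) w :
  (forall i, a i != b i) -> (exists x, x \in supp q) ->
  exists mu, initial_vanish w mu
    (count (fun i => dot w (mvec (a i) - mvec (b i)) == 0) l)
    (mmul (foldr (@mmul n) (mone n) [seq binom (a i) (b i) | i <- l]) q).
Proof.
move=> ab q0.
elim: l => [|i l [mu vmu]] /=.
  have qE h : pair (mmul (mone n) q) h = pair q h.
    rewrite pair_mul /pair big_seq1 mul1r.
    by apply: eq_bigr => t _; rewrite mon0D.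
  have memE x : (x \in supp (mmul (mone n) q)) = (x \in supp q).
    by rewrite !mem_supp !coef_pair qE.
  have [x xq xmin] := seq_argmax (fun x => - dot w (mvec x)) _ q0.
  exists (dot w (mvec x)); split.
  - by move=> y; rewrite memE => /xmin; rewrite lerN2.
  - by exists x; rewrite ?memE.
  - by move=> h h0; rewrite pair_supp big1 // => y _; rewrite h0 !mulr0.
apply: (initial_vanish_binom _ _ _ _ _ _ _ vmu (ab i)) => h.
rewrite !pair_mul pair_binom /pair -sumrB; apply: eq_bigr => t _.
rewrite -mulrBr -sumrB; congr (_ * _); apply: eq_bigr => u _.
by rewrite mulrBr !monDA.
Qed.

(** * Incomparable exponents, positive weights, and the conclusion *)

(** If one exponent were below the other, its monomial would factor out, leaving two nonunits. *)
Lemma pirreducible_not_le {n} (a b : mon n) : a != mon0 n -> b != mon0 n ->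
  pirreducible (binom a b) -> ~~ monle a b /\ ~~ monle b a.
Proof.
move=> a0 b0 [_ [_ irr]].
have binom_nonunit c d : ~ punit (binom c d).
  (* Pairing with the constant 1 evaluates at [(1, ..., 1)], where a binomial vanishes. *)
  case=> v /(pair_peq _ _ (fun=> 1)); rewrite pair_mul pair_binom subrr.
  by rewrite /pair big_seq1.
have mono_nonunit c : c != mon0 n -> ~ punit [:: (1, c)].
  (* A multiple of a nonconstant monomial has zero constant coefficient. *)
  move=> c0 [v /(_ (mon0 n))]; rewrite !coef_pair pair_mul /pair !big_seq1 /=.
  rewrite eqxx big1 // => t _; case: eqP; rewrite ?mulr0 // => ct.
  case/eqP: c0; apply/ffunP => i; have /ffunP/(_ i) := ct; rewrite !ffunE.
  by move/eqP; rewrite addn_eq0 => /andP[/eqP].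
have monB c d : monle c d -> exists e, d = monD c e.
  move=> /forallP cd; exists [ffun i => (d i - c i)%N].
  by apply/ffunP => i; rewrite !ffunE subnKC.
split; apply/negP => /monB[e eE].
- have [|/mono_nonunit|/binom_nonunit] // :=
    irr [:: (1, a)] (binom (mon0 n) e).
  by rewrite eE /mmul /= monD0 !mul1r.
- have [|/mono_nonunit|/binom_nonunit] // :=
    irr [:: (1, b)] (binom e (mon0 n)).
  by rewrite eE /mmul /= monD0 !mul1r.
Qed.

(** The all-ones weight is corrected at a coordinate where [d] has the sign opposite to [s]; scaling
    by that entry's absolute value keeps the weight integral. *)
Lemma pos_orthogonal {n} (d : 'rV[int]_n) i j : 0 < d 0 i -> d 0 j < 0 ->
  exists2 w : 'rV[int]_n, (forall l, 0 < w 0 l) & dot w d = 0.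
Proof.
move=> di dj; pose s := dot (const_mx 1) d.
have [s0|s0] := leP 0 s.
  exists (- d 0 j *: const_mx 1 + s *: delta_mx 0 j).
    move=> l; rewrite !mxE mulr1 ltr_wpDr ?oppr_gt0 // mulr_ge0 //.
  by rewrite !dotE -/s [dot (delta_mx _ _) _]dotC dot_delta; ring.
exists (d 0 i *: const_mx 1 - s *: delta_mx 0 i).
  move=> l; rewrite !mxE mulr1 -mulNr ltr_wpDr // mulr_ge0 //.
  by rewrite oppr_ge0 ltW.
by rewrite !dotE -/s [dot (delta_mx _ _) _]dotC dot_delta; ring.
Qed.

Theorem theorem3p12 (n k : nat) (lam0 lam1 : 'I_k -> mon n)
  (J : finType) (e : J -> int) (alpha : J -> mon n) :
  (forall i, pirreducible (binom (lam0 i) (lam1 i))) ->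
  (forall i i', i != i' -> ~ peq (binom (lam0 i) (lam1 i)) (binom (lam0 i') (lam1 i'))) ->
  (forall i, lam0 i != mon0 n /\ lam1 i != mon0 n) ->
  (0 < #|J|)%N ->
  (forall j, e j = 1 \/ e j = -1) ->
  (forall j j', e j != e j' -> alpha j != alpha j') ->
  exists s : seq (mon n), [/\ uniq s, size s = k.+1 &
    forall b, b \in s -> minimal_monomial (thm_poly lam0 lam1 e alpha) b].
Proof.
move=> irr _ lam_neq0 /card_gt0P[j0 _] e_sign e_alpha.
have nle i : ~~ monle (lam0 i) (lam1 i) /\ ~~ monle (lam1 i) (lam0 i).
  by have [l0 l1] := lam_neq0 i; apply: pirreducible_not_le.
have lam_neq i : lam0 i != lam1 i.
  by apply: contraNneq (nle i).1 => ->; apply/forallP.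
pose q := [seq (e j, alpha j) | j <- enum J].
have q0 : exists x, x \in supp q.
  (* Terms sharing the exponent [alpha j0] share its sign, so they cannot cancel. *)
  exists (alpha j0); rewrite mem_supp /coef big_map big_enum_cond /=.
  rewrite (eq_bigr (fun=> e j0)) => [|j /eqP jj0]; last first.
    by apply/eqP; apply: contraT => /e_alpha; rewrite jj0 eqxx.
  rewrite big_const iter_addr_0 mulrn_eq0 negb_or -lt0n; apply/andP; split.
    by apply/card_gt0P; exists j0; exact: eqxx.
  by case: (e_sign j0) => ->.
set p := thm_poly _ _ _ _.
pose S := [seq mvec b | b <- supp p].
have uS : uniq S by rewrite (map_inj_uniq mvec_inj) supp_uniq.
pose ds := [seq mvec (lam0 i) - mvec (lam1 i) | i <- enum 'I_k].
pose cs := [seq delta_mx 0 i : 'rV[int]_n | i <- enum 'I_n].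
have csP (w : 'rV[int]_n) : reflect (forall i, 0 < w 0 i) (incone cs w).
  rewrite /incone all_map; apply: (iffP allP) => /= w0 i.
    by have := w0 i (mem_enum _ i); rewrite dot_delta.
  by rewrite dot_delta.
have [||| s [us szs sP]] := size_faces S cs ds uS.
- move=> w; rewrite count_map.
  have [mu /initial_vanish_size] :=
    initial_vanish_prod (enum 'I_k) lam0 lam1 q w lam_neq q0.
  by [].
- by exists (const_mx 1); apply/csP => i; rewrite mxE.
- move=> _ /mapP[i _ ->]; split.
    by rewrite subr_eq0 (inj_eq mvec_inj).
  have [/forallPn[x1 +] /forallPn[x2 +]] := nle i; rewrite -!ltnNge => h1 h2.
  have [|| w w0 wd] := pos_orthogonal (mvec (lam0 i) - mvec (lam1 i)) x1 x2.
  - by rewrite !mxE; lia.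
  - by rewrite !mxE; lia.
  by exists w => //; apply/csP.
have sS : {subset s <= S} by move=> x /sP[w _ /faceP[]].
pose t := [seq b <- supp p | mvec b \in s].
have szt : (k < size t)%N.
  rewrite -(size_map mvec); apply: leq_trans (_ : size s <= _)%N.
    by move: szs; rewrite size_map size_enum_ord.
  apply: uniq_leq_size => // x xs; have /mapP[b bp xE] := sS x xs.
  by rewrite xE map_f // mem_filter -xE xs.
exists (take k.+1 t); split.
- by rewrite take_uniq // filter_uniq ?supp_uniq.
- by rewrite size_takel.
move=> b /mem_take; rewrite mem_filter => /andP[/sP[w /csP w0 /faceP[_ bmin]] bp].
split; first by rewrite -mem_supp.
move=> b' b'b; rewrite -mem_supp => b'p; apply/negP => /forallP le.
have := bmin _ (map_f mvec b'p); rewrite leNgt => /negP; apply.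
(* A strict drop in one coordinate makes [b'] strictly lighter than [b], as every weight entry is
   positive. *)
have [i lti] : exists i, (b' i < b i)%N.
  apply/existsP; apply: contraT; rewrite negb_exists => /forallP ge.
  case/eqP: b'b; apply/ffunP => i; apply/eqP; rewrite eqn_leq le.
  by rewrite leqNgt ge.
rewrite /dot !(bigD1 (P := predT) i) //= ltr_leD //.
  by rewrite !mxE ltr_pM2l.
by apply: ler_sum => j _; rewrite !mxE ler_pM2l // lez_nat le.
Qed.
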